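(* Let $X$ be a complete metric space, $Y$ a linear space with a shift-invariant metric, $F:X\rightrightarrows Y$ a set-valued mapping, $(\bar x,\bar y)\in\mathrm{gph}\,F$, $f:X\to Y$ a function with $f(\bar x)=0$, and $q\in(0,1]$. Suppose that $\mathrm{gph}\,F$ is closed near $(\bar x,\bar y)$. Then $$\mathrm{rg}^q(F+f)(\bar x,\bar y)\ \ge\ \mathrm{rg}^qF(\bar x,\bar y)-\mathrm{lip}^qf(\bar x).$$
   Context: For a set-valued mapping $F:X\rightrightarrows Y$: $\mathrm{gph}\,F=\{(x,y)\mid y\in F(x)\}$, $F^{-1}(y)=\{x\in X\mid y\in F(x)\}$, and $(F+f)(x)=\{y+f(x)\mid y\in F(x)\}$. $B_r(x)$ and $\overline B_r(x)$ are the open and closed balls. $d(x,A)=\inf_{a\in A}d(x,a)$, with $d(x,\emptyset)=+\infty$; $d^q(\cdot,\cdot)$ denotes the $q$-th power of $d(\cdot,\cdot)$. A metric $d$ on a vector space $Y$ is shift-invariant if $d(y'+z,y+z)=d(y',y)$ for all $y',y,z\in Y$. The product $X\times Y$ carries the maximum distance. A set $\Omega$ is closed near $\bar\omega\in\Omega$ if there is $\delta>0$ such that $\Omega\cap\overline B_\delta(\bar\omega)$ is closed. Modulus of regularity of order $q$: for a set-valued mapping $G:X\rightrightarrows Y$ and $(\bar x,\bar y)\in\mathrm{gph}\,G$, $\mathrm{rg}^qG(\bar x,\bar y)\in[0,+\infty]$ is the supremum of all $\tau>0$ for which there exists $\delta>0$ such that $\tau\,d(x,G^{-1}(y))\le d^q(y,G(x))$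 for all $x\in B_\delta(\bar x)$ and $y\in B_\delta(\bar y)$; it equals $0$ if no such $\tau$ exists (i.e. if $G$ is not metrically regular of order $q$ at $(\bar x,\bar y)$). Modulus of Hölder continuity: for a function $f:X\to Y$, $\mathrm{lip}^qf(\bar x)\in[0,+\infty]$ is the infimum of all $\tau>0$ for which there exists $\delta>0$ such that $d^q(f(x),f(x'))\le\tau\,d(x,x')$ for all $x,x'\in B_\delta(\bar x)$; it equals $+\infty$ if no such $\tau$ exists. Convention: $(+\infty)-(+\infty)=0$. *)

(* Defs.v *)
From HB Require Import structures.
From mathcomp Require Import all_boot all_order all_algebra.
From mathcomp Require Import all_classical all_reals all_analysis.

Set Implicit Arguments.
Unset Strict Implicit.
Unset Printing Implicit Defensive.

Import Order.TTheory GRing.Theory Num.Theory.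

Local Open Scope classical_set_scope.
Local Open Scope ring_scope.

#[short(type="completeMetricType")]
HB.structure Definition CompleteMetric (R : realType) :=
  { X of Metric R X & Complete X }.

Definition metric_on {R : realType} (Y : lmodType R) : Type := isMetric R Y.

(* The linear space Y with the metric dY. No compatibility between the two is
   assumed (the scalar multiplication need not be continuous). An alias is used
   because Hierarchy Builder rejects a joint structure of Metric and Lmodule
   declared above PseudoMetricNormedZmod. *)
Definition metrized {R : realType} {Y : lmodType R} (dY : metric_on Y) : Type :=
  Y.

Section metrized.
Context {R : realType} {Y : lmodType R} (dY : metric_on Y).

HB.instance Definition _ := GRing.Lmodule.on (metrized dY).
HB.instance Definition _ : isMetric R (metrized dY) := dY.

End metrized.

Section prod_metric.
Context {R : realType} {X Y : metricType R}.

Let pdist (z w : X * Y) : R := Num.max (mdist z.1 w.1) (mdist z.2 w.2).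

Let pdist_ge0 z w : 0 <= pdist z w.
Proof. by rewrite le_max mdist_ge0. Qed.

Let pdist_positivity z w : pdist z w = 0 -> z = w.
Proof.
case: z w => [x y] [x' y'] zw0; have : pdist (x, y) (x', y') <= 0 by rewrite zw0.
rewrite ge_max /= => /andP[x0 y0]; congr pair; apply: mdist_positivity;
  by apply/eqP; rewrite eq_le mdist_ge0 andbT.
Qed.

Let ballEpdist z d : ball z d = [set w | pdist z w < d].
Proof.
apply/seteqP; split=> w; rewrite {1}/ball /= /prod_ball !ballEmdist /= gt_max.
- by case=> -> ->.
- by case/andP.
Qed.

HB.instance Definition _ := @PseudoMetric_isMetric.Build R (X * Y)%type
  pdist pdist_ge0 pdist_positivity ballEpdist.

End prod_metric.

Section metric_notions.
Context {R : realType}.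
Implicit Types X Y : metricType R.

Definition shift_invariant (Y : lmodType R) (dY : metric_on Y) : Prop :=
  forall y' y z : metrized dY, mdist (y' + z) (y + z) = mdist y' y.

(* The library's closed_ball is the closure of the open ball, which can be
   smaller than this set in a general metric space. *)
Definition cball X (x : X) (r : R) : set X := [set x' | mdist x x' <= r].

Definition closed_near X (A : set X) (x : X) : Prop :=
  exists2 d : R, 0 < d & closed (A `&` cball x d).

(* Equal to +oo when A is empty. *)
Definition set_dist X (x : X) (A : set X) : \bar R :=
  ereal_inf [set (mdist x a)%:E | a in A].

End metric_notions.

Section set_valued.
Context {X Y : Type}.

Definition gph (F : X -> set Y) : set (X * Y) := [set z | F z.1 z.2].

Definition setval_inv (F : X -> set Y) (y : Y) : set X := [set x | F x y].

End set_valued.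

Definition setval_add {X : Type} {Y : zmodType} (F : X -> set Y) (f : X -> Y) :
  X -> set Y := fun x => [set y + f x | y in F x].

Section moduli.
Context {R : realType} {X Y : metricType R}.
Local Open Scope ereal_scope.

Definition holder_regular_const (q : R) (G : X -> set Y) (x0 : X) (y0 : Y)
    (t : R) : Prop :=
  exists2 d : R, (0 < d)%R & forall x y, ball x0 d x -> ball y0 d y ->
    t%:E * set_dist x (setval_inv G y) <= set_dist y (G x) `^ q.

(* ereal_sup set0 = -oo, whence the maximum with 0. *)
Definition rg (q : R) (G : X -> set Y) (x0 : X) (y0 : Y) : \bar R :=
  maxe 0 (ereal_sup
    [set t%:E | t in [set t : R | (0 < t)%R /\ holder_regular_const q G x0 y0 t]]).

Definition holder_const (q : R) (f : X -> Y) (x0 : X) (t : R) : Prop :=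
  exists2 d : R, (0 < d)%R & forall x x', ball x0 d x -> ball x0 d x' ->
    (mdist (f x) (f x') `^ q <= t * mdist x x')%R.

Definition lip (q : R) (f : X -> Y) (x0 : X) : \bar R :=
  ereal_inf
    [set t%:E | t in [set t : R | (0 < t)%R /\ holder_const q f x0 t]].

End moduli.

(* The library sets +oo - +oo = -oo. *)
Definition sube_conv {R : realType} (a b : \bar R) : \bar R :=
  if (a == +oo%E) && (b == +oo%E) then 0%E else (a - b)%E.

(* Main.v *)
(* Let t and l be constants of regularity of F and of Hölder continuity of f,
   with l < t.  To solve y in F u + f u starting from x, iterate: pick x_(n+1)
   near x_n with y - f x_n in F x_(n+1).  The residual E_n of x_n (the q-th power
   of the distance from y - f x_n to F x_n) yields a step shorter than E_n / t,
   and the q-th power of the change in f is at most l times the step, so the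
   residuals decay by the factor l / t and the steps add up to E_0 / (t - l).
   Hence t - l is a constant of regularity of F + f. *)
Require Import Defs.
From mathcomp Require Import all_boot all_order all_algebra.
From mathcomp Require Import all_classical all_reals all_analysis.
From mathcomp Require Import ring lra.

Import Order.TTheory GRing.Theory Num.Theory.
Local Open Scope classical_set_scope.
Local Open Scope ring_scope.

Set Implicit Arguments.
Unset Strict Implicit.
Unset Printing Implicit Defensive.

Section perturbation.
Context {R : realType}.
Implicit Types M : metricType R.

(** * Convergence of an iteration with geometric steps *)

(** The steps are dominated by a geometric series of ratio [l / t] and sum [E / (t - l)], so the
    iterates converge by completeness. Since [Q] is an arbitrary relation it need not pass to the
    limit; the conclusion offers consecutive iterates near [u], for a later closedness argument. *)
Lemma geometric_iteration (X : completeMetricType R) (P : X -> R -> Prop)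
    (Q : X -> X -> Prop) (t l : R) (x0 : X) (E : R) :
  0 < l -> l < t -> 0 <= E ->
  (forall x e, P x e ->
    exists x', [/\ Q x x', mdist x x' <= e / t & P x' (l / t * e)]) ->
  P x0 E ->
  exists u, mdist x0 u <= E / (t - l) /\
    forall a, 0 < a -> exists x x', [/\ Q x x', mdist u x < a & mdist u x' < a].
Proof.
move=> l0 lt E0 step P0.
have t0 : 0 < t by exact: lt_trans lt.
have tl0 : 0 < t - l by rewrite subr_gt0.
(* Choice needs a successor for every pair, so [P] becomes a premise and [x] itself serves where it
   fails. *)
have /choice[g gP] : forall p : X * R, exists x', P p.1 p.2 ->
    [/\ Q p.1 x', mdist p.1 x' <= p.2 / t & P x' (l / t * p.2)].
  move=> [x e].
  by have [/step[x' ?]|nP] := pselect (P x e); [exists x'|exists x].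
pose w n := iter n (fun p => (g p, l / t * p.2)) (x0, E).
pose s n := (w n).1.
have w2 n : (w n).2 = (l / t) ^+ n * E.
  by elim: n => [|n IH]; rewrite ?mul1r //= IH exprS mulrA.
have wP n : P (w n).1 (w n).2 by elim: n => [|n /gP[]].
have k0 : 0 <= l / t by rewrite divr_ge0 // ltW.
have k1 : l / t < 1 by rewrite ltr_pdivrMr ?mul1r.
pose D := E / (t - l).
have D0 : 0 <= D by rewrite divr_ge0 // ltW.
(* As [E / t = (1 - l / t) * D], the step bound is a difference of successive terms, and sums of
   steps telescope. *)
have sS n : mdist (s n) (s n.+1) <= ((l / t) ^+ n - (l / t) ^+ n.+1) * D.
  have [_ + _] := gP _ (wP n); rewrite w2 => /le_trans; apply.
  rewrite exprS /D le_eqVlt; apply/orP; left; apply/eqP; field.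
  by rewrite !gt_eqF.
have sD n m :
    mdist (s n) (s (n + m)%N) <= ((l / t) ^+ n - (l / t) ^+ (n + m)) * D.
  elim: m => [|m IH]; first by rewrite addn0 mdistxx subrr mul0r.
  apply: le_trans (metric_triangle _ (s (n + m)%N) _) _.
  rewrite addnS; have := sS (n + m)%N; lra.
have sB n m : mdist (s n) (s (n + m)%N) <= (l / t) ^+ n * D.
  apply: le_trans (sD n m) _; rewrite ler_wpM2r // gerBl; exact: exprn_ge0.
have kD e : 0 < e -> exists n, (l / t) ^+ n * D < e.
  (* [D] may be zero, hence the divisor [D + 1]. *)
  move=> e0; have e1 : 0 < e / (D + 1) by rewrite divr_gt0 // ltr_wpDl.
  have kn : `|l / t| < 1 by rewrite ger0_norm.
  have /cvgrPdist_lt /(_ _ e1)[N _ /(_ N (leqnn N))] /= := cvg_expr kn.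
  rewrite sub0r normrN ger0_norm ?exprn_ge0// ltr_pdivlMr ?ltr_wpDl// => Ne.
  by exists N; apply: le_lt_trans Ne; rewrite ler_wpM2l ?exprn_ge0// lerDl.
have sC : cauchy (s @ \oo).
  apply: cauchy_exP => e e0; have [N Ne] := kD e e0.
  exists (s N); exists N => // n /= Nn; rewrite ballEmdist /=.
  by apply: le_lt_trans Ne; rewrite -(subnKC Nn).
pose u := lim (s @ \oo).
have su : s @ \oo --> u by exact: cauchy_cvg.
have uP a : 0 < a -> exists N, forall n, (N <= n)%N -> mdist u (s n) < a.
  move=> a0; have [N _ NP] := su _ (nbhsx_ballx u a a0).
  by exists N => n /NP /=; rewrite ballEmdist.
exists u; split.
  apply/ler_addgt0Pr => a a0; have [N /(_ N (leqnn N)) Na] := uP a a0.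
  apply: le_trans (metric_triangle _ (s N) _) _; apply: lerD.
    by rewrite -[leRHS]mul1r -[1](expr0 (l / t)) (sB 0 N).
  by rewrite metric_sym ltW.
move=> a a0; have [N NP] := uP a a0.
exists (s N), (s N.+1); split; [by have [] := gP _ (wP N)| |]; exact: NP.
Qed.

Lemma closed_mdist M (A : set M) (z : M) :
  closed A ->
  (forall e, 0 < e -> exists w, A w /\ mdist z w < e) -> A z.
Proof.
move=> Acl Az; apply: Acl => B /nbhs_ballP[e /= e0 eB].
have [w [Aw zw]] := Az e e0; exists w; split=> //; apply: eB.
by rewrite ballEmdist.
Qed.

Lemma set_dist_le M (x a : M) (A : set M) :
  A a -> (set_dist x A <= (mdist x a)%:E)%E.
Proof. by move=> Aa; apply: ereal_inf_lbound; exists a. Qed.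

Lemma set_dist_lt M (x : M) (A : set M) (r : R) :
  (set_dist x A < r%:E)%E -> exists2 a, A a & mdist x a < r.
Proof. by move=> /ereal_inf_lt[_ [a Aa <-]]; exists a. Qed.

Lemma set_dist_ge0 M (x : M) (A : set M) : (0 <= set_dist x A)%E.
Proof. by apply: le_ereal_inf_tmp => _ [a _ <-]; rewrite lee_fin mdist_ge0. Qed.

Lemma set_dist_poweR_le M (x a : M) (A : set M) (q : R) : 0 <= q ->
  A a -> (set_dist x A `^ q <= (mdist x a `^ q)%:E)%E.
Proof.
move=> q0 Aa; rewrite -poweR_EFin; apply: gt0_ler_poweR => //.
- by rewrite in_itv /= set_dist_ge0 leey.
- by rewrite in_itv /= lee_fin mdist_ge0 leey.
- exact: set_dist_le.
Qed.

(** * Solving the perturbed inclusion *)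

(** The ball of radius [c] around [xbar] contains the whole trajectory, and on it [y - f z] stays
    where the regularity of [F] applies. The residual bound [E] is strict because the infimum
    defining the distance need not be attained. *)
Lemma perturbed_solvable (X : completeMetricType R) (Y : lmodType R)
    (dY : metric_on Y) (F : X -> set (metrized dY)) (f : X -> metrized dY)
    (xbar : X) (ybar : metrized dY) (q t l d r : R) :
  shift_invariant dY -> 0 < q -> 0 < l -> l < t -> 0 < r -> r <= d ->
  closed (gph F `&` cball (xbar, ybar) d) ->
  (forall x (y : metrized dY), mdist xbar x < r -> mdist ybar y < r ->
    (t%:E * set_dist x (setval_inv F y) <= set_dist y (F x) `^ q)%E) ->
  (forall x x', mdist xbar x < r -> mdist xbar x' < r ->
    mdist (f x) (f x') `^ q <= l * mdist x x') ->
  forall (x : X) (y : metrized dY) (c E : R), 0 < E ->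
  mdist xbar x + E / (t - l) < c -> c <= r ->
  (forall z, mdist xbar z < c -> mdist ybar (y - f z) < r) ->
  (set_dist (y - f x)%R (F x) `^ q < E%:E)%E ->
  exists2 u, F u (y - f u) & mdist x u <= E / (t - l).
Proof.
move=> dYsh q0 l0 lt r0 rd Fcl Freg fhol x y c E E0 xE cr yr FE.
have t0 : 0 < t by exact: lt_trans lt.
have tl0 : 0 < t - l by rewrite subr_gt0.
(* A shift by [a + b - y] sends [y - a] to [b] and [y - b] to [a]. *)
have dYB (a b : metrized dY) : mdist (y - a) (y - b) = mdist a b :> R.
  rewrite -(dYsh _ _ (a + b - y)) metric_sym.
  by congr mdist; rewrite addrC addrA subrK ?addrK // [a + b]addrC addrK.
(* Of the total length [E / (t - l)], a point with residual bound [e] keeps [e / (t - l)] in reserve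
   for the remaining steps. *)
pose P z e := [/\ 0 < e, mdist x z <= (E - e) / (t - l) &
  (set_dist (y - f z)%R (F z) `^ q < e%:E)%E].
pose Q z z' := [/\ F z' (y - f z), mdist xbar z < c & mdist xbar z' < c].
have inball z e : P z e -> mdist xbar z < c.
  case=> e0 xz _; apply: le_lt_trans (metric_triangle _ x _) _.
  apply: le_lt_trans xE; rewrite lerD2l (le_trans xz) // ler_pM2r ?invr_gt0 //.
  by rewrite gerBl ltW.
have step z e : P z e ->
    exists z', [/\ Q z z', mdist z z' <= e / t & P z' (l / t * e)].
  move=> Pze; have zc := inball _ _ Pze; case: Pze => e0 xz ze.
  have /le_lt_trans/(_ ze) := Freg _ _ (lt_le_trans zc cr) (yr _ zc).
  rewrite muleC -lte_pdivlMr // => /set_dist_lt[z' Fz' zz'].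
  have Pz' : P z' (l / t * e).
    have zz'B : mdist x z' <= (E - l / t * e) / (t - l).
      apply: le_trans (metric_triangle _ z _) _.
      apply: le_trans (lerD xz (ltW zz')) _.
      rewrite le_eqVlt; apply/orP; left; apply/eqP; field.
      by rewrite !gt_eqF.
    have le0 : 0 < l / t * e by rewrite !mulr_gt0 ?invr_gt0.
    have z'c : mdist xbar z' < c.
      apply: le_lt_trans (metric_triangle _ x _) _.
      apply: le_lt_trans xE; rewrite lerD2l (le_trans zz'B) //.
      by rewrite ler_pM2r ?invr_gt0 // gerBl ltW.
    split => //.
    have {}Fz' : F z' (y - f z) by [].
    (* The point [y - f z] of [F z'] bounds the new residual by the change in [f]; the strict bound
       on the step makes it strictly less than [l / t * e]. *)
    apply: le_lt_trans (set_dist_poweR_le _ (ltW q0) Fz') _.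
    rewrite lte_fin dYB metric_sym.
    apply: le_lt_trans (fhol _ _ (lt_le_trans zc cr) (lt_le_trans z'c cr)) _.
    by rewrite -mulrA ltr_pM2l // mulrC.
  exists z'; split=> //; last exact: ltW.
  by split=> //; exact: inball Pz'.
have P0 : P x E by split=> //; rewrite mdistxx subrr mul0r.
have [u [xu uQ]] := geometric_iteration l0 lt (ltW E0) step P0.
exists u => //.
have uc : mdist xbar u < c.
  by apply: le_lt_trans (metric_triangle _ x _) _; apply: le_lt_trans xE;
    rewrite lerD2l.
(* The pairs [(z', y - f z)] of consecutive iterates lie in this closed set and come arbitrarily
   near [(u, y - f u)]. *)
suff [] : (gph F `&` cball (xbar, ybar) d) (u, y - f u) by [].
apply: closed_mdist Fcl _ => e e0.
(* Within this distance of [u], Hölder continuity keeps [f] within [e] of [f u]. *)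
have eq0 : 0 < e `^ q / l by rewrite divr_gt0 // powR_gt0.
have [|z [z' [[Fz' zc z'c]]]] := uQ (Num.min e (e `^ q / l)).
  by rewrite lt_min e0.
rewrite !lt_min => /andP[uz uzq] /andP[uz' _].
exists (z', y - f z); split.
  split => //=; rewrite /cball /= ge_max /=; apply/andP; split.
    exact/ltW/(lt_le_trans z'c)/(le_trans cr).
  exact/ltW/(lt_le_trans (yr _ zc)).
rewrite /mdist /= gt_max uz' /= dYB ltNge; apply/negP => ef.
have := fhol _ _ (lt_le_trans uc cr) (lt_le_trans zc cr).
apply/negP; rewrite -ltNge; move: uzq; rewrite ltr_pdivlMr // mulrC.
move=> /lt_le_trans; apply; apply: ge0_ler_powR => //; first exact: ltW.
- by rewrite nnegrE ltW.
- by rewrite nnegrE mdist_ge0.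
Qed.

(** * Regularity of the perturbed mapping *)

Lemma set_dist_setval_add (X : Type) (Y : lmodType R) (dY : metric_on Y)
    (F : X -> set (metrized dY)) (f : X -> metrized dY) x (y : metrized dY) :
  shift_invariant dY ->
  set_dist y (setval_add F f x) = set_dist (y - f x) (F x).
Proof.
move=> dYsh; rewrite /set_dist /setval_add image_comp; congr ereal_inf.
apply: eq_imagel => a _ /=.
by rewrite -[in RHS](dYsh _ _ (f x)) subrK.
Qed.

(** If the residual at [x] is below a threshold [eta], the iteration from [x] stays in the
    admissible ball and gives the estimate. Otherwise it suffices to find a solution within
    [eta / (t - l)] of [x]. *)
Lemma holder_regular_const_add (X : completeMetricType R) (Y : lmodType R)
    (dY : metric_on Y) (F : X -> set (metrized dY)) (f : X -> metrized dY)
    (xbar : X) (ybar : metrized dY) (q t l : R) :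
  shift_invariant dY -> gph F (xbar, ybar) -> f xbar = 0 -> 0 < q ->
  closed_near (gph F) (xbar, ybar) -> 0 < l -> l < t ->
  holder_regular_const q F xbar ybar t -> holder_const q f xbar l ->
  holder_regular_const q (setval_add F f) xbar ybar (t - l).
Proof.
move=> dYsh Fxy fx0 q0 [d d0 Fcl] l0 lt [d1 d10 Freg] [d2 d20 fhol].
have tl0 : 0 < t - l by rewrite subr_gt0.
pose r := Num.min d (Num.min d1 d2).
have r0 : 0 < r by rewrite !lt_min d0 d10.
have rd : r <= d by rewrite ge_min lexx.
have rd1 : r <= d1 by rewrite !ge_min lexx orbT.
have rd2 : r <= d2 by rewrite !ge_min lexx !orbT.
have {}Freg x (y : metrized dY) : mdist xbar x < r -> mdist ybar y < r ->
    (t%:E * set_dist x (setval_inv F y) <= set_dist y (F x) `^ q)%E.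
  by move=> xr yr; apply: Freg; rewrite ballEmdist /=; exact: lt_le_trans rd1.
have {}fhol x x' : mdist xbar x < r -> mdist xbar x' < r ->
    mdist (f x) (f x') `^ q <= l * mdist x x'.
  by move=> xr x'r; apply: fhol; rewrite ballEmdist /=; exact: lt_le_trans rd2.
have r20 : 0 < r / 2 by rewrite divr_gt0.
have r2q0 : 0 < (r / 2) `^ q by exact: powR_gt0.
(* The second bound makes [f] differ from [f xbar = 0] by less than [r / 2] on this ball; the other
   half of [r] is left for [y]. *)
pose c := Num.min r ((r / 2) `^ q / l).
have c0 : 0 < c by rewrite lt_min r0 divr_gt0.
have cr : c <= r by rewrite ge_min lexx.
have yfz (y : metrized dY) z :
    mdist ybar y < r / 2 -> mdist xbar z < c -> mdist ybar (y - f z) < r.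
  move=> yr zc; apply: le_lt_trans (metric_triangle _ y _) _.
  suff fr : mdist y (y - f z) < r / 2 by rewrite [r]splitr ltrD.
  have <- : mdist (f xbar) (f z) = mdist y (y - f z).
    rewrite fx0 -[LHS](dYsh _ _ (y - f z)) add0r [f z + _]addrC subrK.
    exact: metric_sym.
  rewrite ltNge; apply/negP => rf.
  have xr : mdist xbar xbar < r by rewrite mdistxx.
  have := fhol _ _ xr (lt_le_trans zc cr); apply/negP; rewrite -ltNge.
  move: zc; rewrite lt_min => /andP[_]; rewrite ltr_pdivlMr // mulrC.
  move=> /lt_le_trans; apply; apply: ge0_ler_powR => //; first exact: ltW.
  - by rewrite nnegrE ltW.
  - by rewrite nnegrE mdist_ge0.
(* A residual bound of at most [eta] gives a trajectory of length at most [c / 2]. *)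
pose eta := (t - l) * (c / 2).
have eta0 : 0 < eta by rewrite mulr_gt0 // divr_gt0.
(* The bounds serve, in order, to keep [y - f z] near [ybar], to keep [x] near [xbar], and to make
   the residual at [xbar] at most [eta / 4]. *)
pose e := Num.min (Num.min (r / 2) (c / 4)) ((eta / 4) `^ q^-1).
have e0 : 0 < e by rewrite !lt_min r20 divr_gt0 //= powR_gt0 // divr_gt0.
have er : e <= r / 2 by rewrite !ge_min lexx.
have ec : e <= c / 4 by rewrite !ge_min lexx orbT.
have eeta : e `^ q <= eta / 4.
  have eta40 : 0 <= eta / 4 by rewrite divr_ge0 // ltW.
  have -> : eta / 4 = ((eta / 4) `^ q^-1) `^ q.
    by rewrite -powRrM mulVf ?gt_eqF // powRr1.
  apply: ge0_ler_powR; rewrite ?nnegrE ?powR_ge0 ?(ltW q0) ?(ltW e0) //.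
  by rewrite ge_min lexx orbT.
have solve x (y : metrized dY) E :
    mdist xbar x < e -> mdist ybar y < e -> 0 < E -> E <= eta ->
    (set_dist (y - f x)%R (F x) `^ q < E%:E)%E ->
    exists2 u, setval_inv (setval_add F f) y u & mdist x u <= E / (t - l).
  move=> xe ye E0 Eeta FE.
  have xE : mdist xbar x + E / (t - l) < c.
    have : E / (t - l) <= c / 2 by rewrite ler_pdivrMr // mulrC.
    by move: xe ec c0; lra.
  have [u Fu xu] := perturbed_solvable dYsh q0 l0 lt r0 rd Fcl Freg fhol E0
    xE cr (fun z => yfz y z (lt_le_trans ye er)) FE.
  by exists u => //; exists (y - f u); rewrite ?subrK.
exists e => // x y; rewrite !ballEmdist /= => xe ye.
rewrite set_dist_setval_add //.
have dist_le u E :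
    setval_inv (setval_add F f) y u -> mdist x u <= E / (t - l) ->
    ((t - l)%:E * set_dist x (setval_inv (setval_add F f) y) <= E%:E)%E.
  move=> yu xu; rewrite muleC -lee_pdivlMr //.
  apply: le_trans (set_dist_le x yu) _.
  by rewrite lee_fin.
have [Deta|Deta] := ltP (set_dist (y - f x)%R (F x) `^ q)%E eta%:E.
  have Dfin : (set_dist (y - f x)%R (F x) `^ q)%E \is a fin_num.
    by rewrite ge0_fin_numE ?poweR_ge0 // (lt_trans Deta) // ltry.
  move: (Deta); rewrite -(fineK Dfin); set D := fine _; rewrite lte_fin => DE.
  apply/lee_addgt0Pr => a a0; rewrite -EFinD.
  (* A strict bound on the residual is required, so [D] is enlarged by an arbitrary [a]; the cap
     respects the limit [eta] and still exceeds [D]. *)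
  pose E := Num.min (D + a) eta.
  have D0 : 0 <= D by rewrite fine_ge0 // poweR_ge0.
  have DltE : D < E by rewrite lt_min DE ltrDl a0.
  have [|||u yu xu] := solve x y E xe ye.
  - exact: le_lt_trans DltE.
  - by rewrite ge_min lexx orbT.
  - by rewrite -(fineK Dfin) lte_fin.
  - apply: le_trans (dist_le _ _ yu xu) _.
    by rewrite lee_fin ge_min lexx.
apply: le_trans Deta.
(* A large residual at x is harmless: solve from xbar, whose residual is small. *)
have [|||||u yu xu] := solve xbar y (eta / 2).
- by rewrite mdistxx.
- exact: ye.
- by rewrite divr_gt0.
- lra.
- apply: le_lt_trans (set_dist_poweR_le _ (ltW q0) (Fxy : F xbar ybar)) _.
  rewrite fx0 subr0 lte_fin metric_sym.
  apply: (@le_lt_trans _ _ (eta / 4)); last lra.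
  apply: le_trans eeta; apply: ge0_ler_powR;
    rewrite ?nnegrE ?mdist_ge0 ?(ltW q0)//.
  + exact: ltW.
  + exact: ltW.
apply: (dist_le u) => //; apply: le_trans (metric_triangle _ xbar _) _.
rewrite metric_sym.
(* The summands bound the way from [x] to [xbar] and the way from [xbar] to [u]. *)
have -> : eta / (t - l) = c / 4 + eta / 2 / (t - l).
  by rewrite /eta; field; rewrite gt_eqF.
by rewrite lerD // (le_trans (ltW xe)).
Qed.
End perturbation.

Theorem theorem4p1 (R : realType) (X : completeMetricType R)
    (Y : lmodType R) (dY : metric_on Y) (hY : shift_invariant dY)
    (F : X -> set (metrized dY)) (xbar : X) (ybar : metrized dY)
    (hxy : gph F (xbar, ybar))
    (f : X -> metrized dY) (hf : f xbar = 0) (q : R) (hq0 : 0 < q) (hq1 : q <= 1)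
    (hcl : closed_near (gph F) (xbar, ybar)) :
  (sube_conv (rg q F xbar ybar) (lip q f xbar)
     <= rg q (setval_add F f) xbar ybar)%E.
Proof.
set g := rg q (setval_add F f) xbar ybar; set L := lip q f xbar.
have g0 : (0 <= g)%E by rewrite le_max lexx.
have L0 : (0 <= L)%E.
  by apply: le_ereal_inf_tmp => _ [l [l0 _] <-]; rewrite lee_fin ltW.
have gP t l : 0 < t -> holder_regular_const q F xbar ybar t ->
    0 < l -> holder_const q f xbar l -> ((t - l)%:E <= g)%E.
  move=> t0 Ft l0 fl; have [tl|lt] := leP t l.
    by apply: le_trans g0; rewrite lee_fin subr_le0.
  rewrite le_max; apply/orP; right; apply: ereal_sup_ubound.
  exists (t - l) => //; split; first by rewrite subr_gt0.
  exact: holder_regular_const_add.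
(* Once [g] and [L] are finite, terms can be moved across the inequality, which reduces it to [gP]
   for each single [t] and [l]. The infinite cases are settled first, the conventional value 0 by
   [g0]. *)
have [->|gNy] := eqVneq g +oo%E; first exact: leey.
have gfin : g \is a fin_num by rewrite ge0_fin_numE // ltey.
rewrite /sube_conv; case: ifPn => // rL.
have [Ly|LNy] := eqVneq L +oo%E.
  by move: rL; rewrite Ly eqxx andbT; case: rg => // *; rewrite leNye.
have Lfin : L \is a fin_num by rewrite ge0_fin_numE // ltey.
rewrite leeBlDr // ge_max adde_ge0 //=.
apply: ge_ereal_sup => _ [t [t0 Ft] <-].
rewrite -leeBlDl //; apply: le_ereal_inf_tmp => _ [l [l0 fl] <-].
by rewrite leeBlDl // -leeBlDr //; exact: gP.
Qed.
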